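(* Let $G_1,G_2,G_k$ be generators over $\Sigma_1,\Sigma_2,\Sigma_k$, respectively, with $\Sigma_1\cap\Sigma_2\subseteq\Sigma_k\subseteq\Sigma_1\cup\Sigma_2$. Let $K\subseteq L_m(G_1\| G_2\| G_k)$ be a specification such that both $K$ and its prefix closure $\overline{K}$ are conditionally decomposable with respect to $\Sigma_1,\Sigma_2,\Sigma_k$. Then there exist nonblocking supervisors $S_k$ (for $G_k$, with observation projection $Q_k$) and $S_i$ (for $G_i\|(S_k/G_k)$, with observation projection $Q_{i+k}$), $i=1,2$, satisfying $L_m(S_k/G_k)\subseteq P_k(K)$ and $L_m(S_i/[G_i\|(S_k/G_k)])\subseteq P_{i+k}(K)$ for $i=1,2$, such that \[ L_m(S_1/[G_1\|(S_k/G_k)])\parallel L_m(S_2/[G_2\|(S_k/G_k)])=K \] if and only if $K$ is (i) conditionally controllable with respect to $G_1,G_2,G_k$ and $\Sigma_{1,u},\Sigma_{2,u},\Sigma_{k,u}$, (ii) conditionally closed with respect to $G_1,G_2,G_k$, and (iii) conditionally observable with respect to $G_1,G_2,G_k$, the event sets $\Sigma_{1,c},\Sigma_{2,c},\Sigma_{k,c}$, and the projections $Q_{1+k},Q_{2+k},Q_k$.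
   Context: An event set is a finite nonempty set $\Sigma$; a language over $\Sigma$ is a subset of the set $\Sigma^*$ of finite words, and the specification $K$ is a regular language. $\overline{L}$ denotes the prefix closure of $L$. A generator over $\Sigma$ is $G=(Q,\Sigma,f,q_0,Q_m)$ with finite nonempty state set $Q$, partial transition function $f:Q\times\Sigma\to Q$ (extended to words), initial state $q_0$, marked states $Q_m\subseteq Q$; $L(G)=\{s\in\Sigma^*: f(q_0,s)\text{ is defined}\}$ and $L_m(G)=\{s\in\Sigma^*: f(q_0,s)\in Q_m\}$. For $\Sigma_0\subseteq\Sigma$, the projection $\Sigma^*\to\Sigma_0^*$ is the homomorphism erasing events outside $\Sigma_0$ and fixing those in $\Sigma_0$. For $L_i\subseteq\Sigma_i^*$, $L_1\parallel L_2=\{w\in(\Sigma_1\cup\Sigma_2)^*: P_i(w)\in L_i,\ i=1,2\}$, where $P_i$ is the projection to $\Sigma_i^*$. $G_1\|G_2$ is the parallel composition, with $L(G_1\|G_2)=L(G_1)\parallel L(G_2)$ and $L_m(G_1\|G_2)=L_m(G_1)\parallel L_m(G_2)$. The set $\Sigma_1\cup\Sigma_2$ is partitioned into controllable events $\Sigma_c$ and uncontrollable events $\Sigma_u$, and $\Sigma_o\subseteq\Sigma_1\cup\Sigma_2$ is the set of observable events. Notation, for $i=1,2$: $\Sigma_{i+k}=\Sigma_i\cup\Sigma_k$; for $j\in\{1,2,k,1+k,2+k\}$, $\Sigma_{j,u}=\Sigma_j\cap\Sigma_u$, $\Sigma_{j,c}=\Sigma_j\cap\Sigma_c$, $\Sigma_{j,o}=\Sigma_j\cap\Sigma_o$;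 $P_k:(\Sigma_1\cup\Sigma_2)^*\to\Sigma_k^*$, $P_{i+k}:(\Sigma_1\cup\Sigma_2)^*\to\Sigma_{i+k}^*$ and $Q_j:\Sigma_j^*\to\Sigma_{j,o}^*$, $j\in\{1+k,2+k,k\}$, are projections. $K$ is conditionally decomposable with respect to $\Sigma_1,\Sigma_2,\Sigma_k$ if $K=P_{1+k}(K)\parallel P_{2+k}(K)$. Supervisors. For a plant $G$ over $\Sigma$ with uncontrollable events $\Sigma_u$ and observation projection $P:\Sigma^*\to\Sigma_o^*$, a supervisor is a map $S:P(L(G))\to\{\gamma\subseteq\Sigma:\Sigma_u\subseteq\gamma\}$. The closed-loop language $L(S/G)$ is the smallest language with $\varepsilon\in L(S/G)$ (empty word) and: if $s\in L(S/G)$, $sa\in L(G)$, $a\in S(P(s))$, then $sa\in L(S/G)$. $L_m(S/G)=L(S/G)\cap L_m(G)$. $S$ is nonblocking if $\overline{L_m(S/G)}=L(S/G)$. The closed loop $S_k/G_k$ is treated as a plant over $\Sigma_k$ with generated language $L(S_k/G_k)$ and marked language $L_m(S_k/G_k)$, so $G_i\|(S_k/G_k)$ is a plant over $\Sigma_{i+k}$ with generated language $L(G_i)\parallel L(S_k/G_k)$ and marked language $L_m(G_i)\parallel L_m(S_k/G_k)$. A language $M$ is controllable with respect to prefix-closed $L$ and $\Sigma'_u$ if $\overline{M}\Sigma'_u\cap L\subseteq\overline{M}$. $M$ is observable with respect to prefix-closed $L$, controllable events $\Sigma'_c$, and a projection $Q$ if for all $s\in\overline{M}$ and $\sigma\in\Sigma'_c$: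 $s\sigma\notin\overline{M}$ and $s\sigma\in L$ imply $Q^{-1}[Q(s)]\sigma\cap\overline{M}=\emptyset$. $M$ is $N$-closed if $M=\overline{M}\cap N$. For $K\subseteq L_m(G_1\|G_2\|G_k)$: - conditionally controllable: $P_k(K)$ is controllable with respect to $L(G_k)$ and $\Sigma_{k,u}$, and for $i=1,2$, $P_{i+k}(K)$ is controllable with respect to $L(G_i)\parallel\overline{P_k(K)}$ and $\Sigma_{i+k,u}$; - conditionally closed: $K$ is nonempty, $P_k(K)$ is $L_m(G_k)$-closed, and for $i=1,2$, $P_{i+k}(K)$ is $(L_m(G_i)\parallel P_k(K))$-closed; - conditionally observable: $P_k(K)$ is observable with respect to $L(G_k)$, $\Sigma_{k,c}$, $Q_k$, and for $i=1,2$, $P_{i+k}(K)$ is observable with respect to $L(G_i)\parallel\overline{P_k(K)}$, $\Sigma_{i+k,c}$, $Q_{i+k}$. *)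

(* Defs.v *)
From HB Require Import structures.
From mathcomp Require Import all_boot.
From mathcomp Require Import boolp classical_sets.

Set Implicit Arguments.
Unset Strict Implicit.
Unset Printing Implicit Defensive.

Local Open Scope classical_set_scope.

(* All event sets are subsets of one ambient finite type [E]; a word over an
   event set [A] is a [w : seq E] all of whose letters are in [A], and a
   language over [A] is a set of such words. *)
Section Languages.
Variable E : finType.
Implicit Types (A B Ac Ao Au Ak : {set E}) (K L M N : set (seq E)) (s t w : seq E).

Definition words A : set (seq E) := [set w : seq E | {subset w <= A}].

Definition prefix_closure L : set (seq E) := [set s | exists t, L (s ++ t)].

(* The projection to A^*; its domain is left implicit, since the formula
   is the same on every B^*. *)
Definition proj A w : seq E := [seq a <- w | a \in A].

Definition lang_par A L B M : set (seq E) :=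
  [set w | [/\ words (A :|: B) w, L (proj A w) & M (proj B w)]].

(* [Au] is the set of uncontrollable events. *)
Definition controllable M L Au : Prop :=
  [set rcons s a | s in prefix_closure M & a in [set` Au]] `&` L
    `<=` prefix_closure M.

(* [M] is a language over [A], [Ac] the set of controllable events, and the
   observation is the projection Q : A^* -> Ao^*. *)
Definition observable A M L Ac Ao : Prop :=
  forall s a, prefix_closure M s -> a \in Ac ->
    ~ prefix_closure M (rcons s a) -> L (rcons s a) ->
    [set rcons t a | t in words A `&` proj Ao @^-1` [set proj Ao s]]
      `&` prefix_closure M = set0.

Definition lang_closed M N : Prop := M = prefix_closure M `&` N.

Definition cond_decomposable A1 A2 Ak K : Prop :=
  K = lang_par (A1 :|: Ak) (proj (A1 :|: Ak) @` K)
               (A2 :|: Ak) (proj (A2 :|: Ak) @` K).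

End Languages.

Section Generators.
Variable E : finType.
Implicit Types A B : {set E}.

Record generator A := Generator {
  state : finType;
  trans : state -> E -> option state;
  trans_dom : forall q a, a \notin A -> trans q a = None;
  init : state;
  marked : {set state} }.

Definition run A (G : generator A) (q : state G) (w : seq E) :
    option (state G) :=
  foldl (fun oq a => obind (fun q' => trans q' a) oq) (Some q) w.

Definition gen_lang A (G : generator A) : set (seq E) :=
  [set w | run (init G) w != None].

Definition gen_mlang A (G : generator A) : set (seq E) :=
  [set w | exists2 q, run (init G) w = Some q & q \in marked G].

Definition regular A (L : set (seq E)) : Prop :=
  exists G : generator A, gen_mlang G = L.

Section Par.
Variables (A B : {set E}) (G : generator A) (H : generator B).

(* A component stays put on the events outside its event set. *)
Definition local_step C (F : generator C) (q : state F) (a : E) :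
    option (state F) :=
  if a \in C then trans q a else Some q.

Definition par_trans (q : state G * state H) (a : E) :
    option (state G * state H) :=
  if a \in A :|: B then
    match local_step q.1 a, local_step q.2 a with
    | Some q1, Some q2 => Some (q1, q2)
    | _, _ => None
    end
  else None.

Lemma par_trans_dom q a : a \notin A :|: B -> par_trans q a = None.
Proof. by rewrite /par_trans => /negbTE ->. Qed.

Definition gen_par : generator (A :|: B) :=
  @Generator (A :|: B) (state G * state H)%type par_trans par_trans_dom
    (init G, init H) (finset.setX (marked G) (marked H)).

End Par.

Lemma run_cons A (G : generator A) (q : state G) a w :
  run q (a :: w) = obind (fun q' => run q' w) (trans q a).
Proof.
rewrite /run /=; case: (trans q a) => //=.
by elim: w.
Qed.

Lemma run_par A B (G : generator A) (H : generator B) q w :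
  run (q : state (gen_par G H)) w =
  if all (mem (A :|: B)) w then
    match run q.1 (proj A w), run q.2 (proj B w) with
    | Some q1, Some q2 => Some (q1, q2)
    | _, _ => None
    end
  else None.
Proof.
elim: w q => [|a w IH] q; first by case: q.
rewrite run_cons /= /par_trans /local_step /=.
case: ifP => //= aAB; rewrite /proj /=.
case: ifP => aA; case: ifP => aB; rewrite ?run_cons.
- case: (trans q.1 a) => [q1|] /=; last by rewrite if_same.
  case: (trans q.2 a) => [q2|] /=; first exact: IH.
  by case: (run q1 _); rewrite if_same.
- by case: (trans q.1 a) => [q1|] /=; [exact: IH | rewrite if_same].
- case: (trans q.2 a) => [q2|] /=; first exact: IH.
  by case: (run q.1 _); rewrite if_same.
- by move: aAB; rewrite finset.in_setU aA aB.
Qed.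

Lemma gen_lang_par A B (G : generator A) (H : generator B) :
  gen_lang (gen_par G H) = lang_par A (gen_lang G) B (gen_lang H).
Proof.
rewrite /gen_lang /lang_par /words; apply/seteqP; split=> w /=.
- rewrite run_par; case: ifP => // /allP AB.
  by case: (run _ _) => [q1|] //; case: (run _ _) => [q2|].
- case=> /allP AB; rewrite run_par AB /=.
  by case: (run _ _) => [q1|] //; case: (run _ _).
Qed.

Lemma gen_mlang_par A B (G : generator A) (H : generator B) :
  gen_mlang (gen_par G H) = lang_par A (gen_mlang G) B (gen_mlang H).
Proof.
rewrite /gen_mlang /lang_par /words; apply/seteqP; split=> w /=.
- case=> q; rewrite run_par; case: ifP => // /allP AB /=.
  case: (run _ _) => [q1|] //; case: (run _ _) => [q2|] // [<-].
  by rewrite finset.in_setX => /andP[m1 m2]; split=> //; [exists q1 | exists q2].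
- case=> /allP AB [q1 r1 m1] [q2 r2 m2]; exists (q1, q2).
    by rewrite run_par AB /= r1 r2.
  by rewrite finset.in_setX m1.
Qed.

End Generators.

Section Supervisors.
Variable E : finType.
Implicit Types A B Au Ao : {set E}.

Record plant A := Plant { plang : set (seq E); pmlang : set (seq E) }.

Definition plant_of_gen A (G : generator A) : plant A :=
  Plant A (gen_lang G) (gen_mlang G).

Definition plant_par A B (G : plant A) (H : plant B) : plant (A :|: B) :=
  Plant (A :|: B) (lang_par A (plang G) B (plang H))
                  (lang_par A (pmlang G) B (pmlang H)).

(* [Au] and [Ao] are the uncontrollable and the observable events of [A].
   The domain of a supervisor is the set of observations of words generated by
   the plant; [sup_map] is a total function, arbitrary outside that set and
   never evaluated there by [closed_loop_lang]. *)
Record supervisor A Au Ao (G : plant A) := Supervisor {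
  sup_map :> seq E -> {set E};
  sup_mapP : forall t, (proj Ao @` plang G) t ->
    (sup_map t \subset A) && (Au \subset sup_map t) }.

Section ClosedLoop.
Variables (A Au Ao : {set E}) (G : plant A) (S : supervisor Au Ao G).

Inductive closed_loop_lang : seq E -> Prop :=
| closed_loop_nil : closed_loop_lang [::]
| closed_loop_rcons s a :
    closed_loop_lang s -> plang G (rcons s a) -> a \in S (proj Ao s) ->
    closed_loop_lang (rcons s a).

Definition closed_loop : plant A :=
  Plant A closed_loop_lang (closed_loop_lang `&` pmlang G).

Definition nonblocking : Prop :=
  prefix_closure (pmlang closed_loop) = plang closed_loop.

End ClosedLoop.
End Supervisors.

Coercion plant_of_gen : generator >-> plant.

Section Conditional.
Variables (E : finType) (A1 A2 Ak : {set E}).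
Variables (G1 : generator A1) (G2 : generator A2) (Gk : generator Ak).
Implicit Types (Su Sc So : {set E}) (K : set (seq E)).

Definition cond_controllable Su K : Prop :=
  let PkK := proj Ak @` K in
  [/\ controllable PkK (gen_lang Gk) (Ak :&: Su),
      controllable (proj (A1 :|: Ak) @` K)
        (lang_par A1 (gen_lang G1) Ak (prefix_closure PkK))
        ((A1 :|: Ak) :&: Su)
    & controllable (proj (A2 :|: Ak) @` K)
        (lang_par A2 (gen_lang G2) Ak (prefix_closure PkK))
        ((A2 :|: Ak) :&: Su)].

Definition cond_closed K : Prop :=
  let PkK := proj Ak @` K in
  [/\ K !=set0,
      lang_closed PkK (gen_mlang Gk),
      lang_closed (proj (A1 :|: Ak) @` K)
        (lang_par A1 (gen_mlang G1) Ak PkK)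
    & lang_closed (proj (A2 :|: Ak) @` K)
        (lang_par A2 (gen_mlang G2) Ak PkK)].

Definition cond_observable Sc So K : Prop :=
  let PkK := proj Ak @` K in
  [/\ observable Ak PkK (gen_lang Gk) (Ak :&: Sc) (Ak :&: So),
      observable (A1 :|: Ak) (proj (A1 :|: Ak) @` K)
        (lang_par A1 (gen_lang G1) Ak (prefix_closure PkK))
        ((A1 :|: Ak) :&: Sc) ((A1 :|: Ak) :&: So)
    & observable (A2 :|: Ak) (proj (A2 :|: Ak) @` K)
        (lang_par A2 (gen_lang G2) Ak (prefix_closure PkK))
        ((A2 :|: Ak) :&: Sc) ((A2 :|: Ak) :&: So)].

End Conditional.

(* Main.v *)
Require Import Defs.
From HB Require Import structures.
From mathcomp Require Import all_boot.
From mathcomp Require Import boolp classical_sets.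

(** Everything reduces to the classical theorem on one supervised plant under
    partial observation, [realizationP]: a language [M] is the marked language
    of a nonblocking closed loop exactly when it is nonempty, controllable,
    observable and closed relative to the marked language of the plant.  A
    nonblocking supervisor makes the generated language of the loop the prefix
    closure of [M], so that necessity can be read off the definition of the
    loop; for sufficiency, the supervisor enables, after an observation [t],
    the uncontrollable events and the events by which some word observed as [t]
    extends within the prefix closure of [M].

    Once the coordinator loop is nonblocking with marked language [Pk K], it is
    the plant with generated language the closure of [Pk K] and marked language
    [Pk K] ([nonblocking_closed_loopE]).  The conditional properties of [K] are
    then literally the conditions of [realizationP] for the plant [Gk] and the
    language [Pk K], and for the plants [Gi || (Sk / Gk)] and the languages
    [P_(i+k) K].

    It remains to see that the requirement on the supervisors says that the
    three marked languages equal the projections of [K].  In one direction this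
    is the conditional decomposability of [K].  In the other, projecting
    [M1 || M2 = K] gives the inclusion of [P_(i+k) K] in [Mi], and projecting
    once more, inside [G1 || (Sk / Gk)], gives that of [Pk K] in [Mk]; the
    reverse inclusions are assumed. *)

Set Implicit Arguments.
Unset Strict Implicit.
Unset Printing Implicit Defensive.

Local Open Scope classical_set_scope.

(** * Prefix closures and projections *)

Section Languages.
Variable E : finType.
Implicit Types (A B : {set E}) (L M N : set (seq E)) (s t w : seq E).

Lemma prefix_closure_mono M N :
  M `<=` N -> prefix_closure M `<=` prefix_closure N.
Proof. by move=> MN s [t Mst]; exists t; apply: MN. Qed.

Lemma prefix_closure_rcons M s a :
  prefix_closure M (rcons s a) -> prefix_closure M s.
Proof. by case=> t; rewrite cat_rcons; exists (a :: t). Qed.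

Lemma prefix_closure_neq0 M : (prefix_closure M [::]) <-> (M !=set0).
Proof. by split=> -[t]; exists t. Qed.

Lemma proj_cat A s t : proj A (s ++ t) = proj A s ++ proj A t.
Proof. exact: filter_cat. Qed.

Lemma proj_proj A B w : B \subset A -> proj B (proj A w) = proj B w.
Proof.
move=> /fintype.subsetP sBA; rewrite /proj -filter_predI.
apply: eq_filter => a /=; case aB: (a \in B) => //=.
exact: sBA.
Qed.

Lemma prefix_closure_lang_par A B L M :
  prefix_closure (lang_par A L B M)
    `<=` lang_par A (prefix_closure L) B (prefix_closure M).
Proof.
move=> s [t [Wst]]; rewrite !proj_cat => Ls Ms.
split; [|by exists (proj A t)|by exists (proj B t)].
by move=> a sa; apply: Wst; rewrite mem_cat sa.
Qed.

Lemma lang_par_mono A B L L' M M' :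
  L `<=` L' -> M `<=` M' -> lang_par A L B M `<=` lang_par A L' B M'.
Proof. by move=> LL' MM' w [Ww Lw Mw]; split; [|exact: LL'|exact: MM']. Qed.

Lemma proj_lang_par_subl A B L M : proj A @` lang_par A L B M `<=` L.
Proof. by move=> _ [w [_ Lw _] <-]. Qed.

Lemma proj_lang_par_subr A B L M : proj B @` lang_par A L B M `<=` M.
Proof. by move=> _ [w [_ _ Mw] <-]. Qed.

End Languages.

(** * Proper plants *)

Section ProperPlants.
Variable E : finType.
Implicit Types A B Au Ao : {set E}.

(** A plant is an arbitrary pair of languages; these are the properties that
    make it behave as the two languages of a generator.  Supervising a plant
    and composing two plants preserve them. *)
Definition proper_plant A (G : plant A) : Prop :=
  [/\ plang G [::], prefix_closure (pmlang G) `<=` plang G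
    & plang G `<=` words A].

Lemma run_cat A (G : generator A) (q : state G) s t :
  run q (s ++ t) = obind (fun q' => run q' t) (run q s).
Proof.
elim: s q => [//|a s IH] q; rewrite cat_cons !run_cons.
by case: (trans q a).
Qed.

Lemma proper_gen A (G : generator A) : proper_plant G.
Proof.
split=> //=.
- move=> s [t [q]]; rewrite run_cat /gen_lang /=.
  by case: (run _ s).
- move=> w; change (run (init G) w != None -> {subset w <= A}).
  elim: w (init G) => [//|b w IH] q; rewrite run_cons.
  have [bA|/trans_dom -> //] := boolP (b \in A).
  case: (trans q b) => [q'|] //= /IH wA a.
  by rewrite inE => /predU1P[->|/wA].
Qed.

Lemma proper_plant_par A B (G : plant A) (H : plant B) :
  proper_plant G -> proper_plant H -> proper_plant (plant_par G H).
Proof.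
move=> [G0 Gm _] [H0 Hm _]; split=> /=.
- by split.
- apply: subset_trans (@prefix_closure_lang_par _ _ _ _ _) _.
  exact: lang_par_mono.
- by move=> w [].
Qed.

Section ClosedLoop.
Variables (A Au Ao : {set E}) (G : plant A) (S : supervisor Au Ao G).

Lemma closed_loop_sub_plang :
  plang G [::] -> closed_loop_lang S `<=` plang G.
Proof. by move=> G0 w; case. Qed.

Lemma closed_loop_rconsP s a :
  closed_loop_lang S (rcons s a) <->
  [/\ closed_loop_lang S s, plang G (rcons s a) & a \in S (proj Ao s)].
Proof.
split=> [|[]]; last exact: closed_loop_rcons.
move: {-1}(rcons s a) (erefl (rcons s a)) => w Ew Cw.
case: Cw Ew => [|s' a' Cs' Gs' Sa'] Ew; first by case: s Ew.
by have [-> ->] := rcons_inj Ew.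
Qed.

Lemma proper_closed_loop :
  proper_plant G -> nonblocking S -> proper_plant (closed_loop S).
Proof.
move=> [G0 _ GA] nbS; split; first exact: closed_loop_nil.
  by rewrite nbS.
exact: subset_trans (closed_loop_sub_plang G0) GA.
Qed.

Lemma nonblocking_closed_loopE M :
  nonblocking S -> pmlang (closed_loop S) = M ->
  closed_loop S = Plant A (prefix_closure M) M.
Proof. by move=> nbS <-; rewrite nbS. Qed.

End ClosedLoop.
End ProperPlants.

(** * Realization by a nonblocking supervisor *)

Section Realization.
Variables (E : finType) (A Au Ac Ao : {set E}) (G : plant A).
Implicit Types M : set (seq E).

Lemma closed_loop_controllable (S : supervisor Au Ao G) M :
  plang G [::] -> closed_loop_lang S = prefix_closure M ->
  controllable M (plang G) Au.
Proof.
move=> G0 CM _ [[s Ms [a aAu <-]] Gsa]; rewrite -CM.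
rewrite -CM in Ms; apply/closed_loop_rconsP; split=> //.
have /andP[_ /fintype.subsetP AuS] : (S (proj Ao s) \subset A)
    && (Au \subset S (proj Ao s)).
  by apply: sup_mapP; exists s => //; apply: closed_loop_sub_plang Ms.
exact: AuS.
Qed.

(** The supervisor sees words only through their observations, so it cannot
    enable an event after one word and disable it after an indistinguishable
    one. *)
Lemma closed_loop_observable (S : supervisor Au Ao G) M :
  closed_loop_lang S = prefix_closure M -> observable A M (plang G) Ac Ao.
Proof.
move=> CM s a; rewrite -CM => Cs _ nCsa Gsa.
apply/seteqP; split=> // _ [[t [_ /= Ets] <-]].
move=> /closed_loop_rconsP[_ _ aS].
by apply: nCsa; apply/closed_loop_rconsP; rewrite -Ets.
Qed.

(** Any supervisor whose loop generates the prefix closure of [M] enables at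
    least these events after each observation of the plant, so this is the most
    restrictive candidate; controllability and observability of [M] make it
    restrictive enough. *)
Definition enabled M (t : seq E) : {set E} :=
  Au :|: [set a in A | `[< exists s, proj Ao s = t
                                  /\ prefix_closure M (rcons s a) >]].

Hypothesis Acu : A = Ac :|: Au.

Lemma enabledP M t :
  (proj Ao @` plang G) t -> (enabled M t \subset A) && (Au \subset enabled M t).
Proof.
move=> _; rewrite finset.subsetUl andbT finset.subUset {1}Acu finset.subsetUr.
by apply/fintype.subsetP => a; rewrite inE => /andP[].
Qed.

Definition realizer M : supervisor Au Ao G :=
  @Supervisor E A Au Ao G (enabled M) (@enabledP M).

Lemma realizer_closed_loop M :
  M !=set0 -> prefix_closure M `<=` plang G -> prefix_closure M `<=` words A ->
  controllable M (plang G) Au -> observable A M (plang G) Ac Ao ->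
  closed_loop_lang (realizer M) = prefix_closure M.
Proof.
move=> /prefix_closure_neq0 M0 MG MA cM oM; apply/seteqP; split=> w.
- elim=> {w} [//|s a _ Ms Gsa].
  rewrite /= /enabled finset.in_setU inE.
  have cMu : a \in Au -> prefix_closure M (rcons s a).
    by move=> aAu; apply: cM; split=> //; exists s => //; exists a.
  case/orP=> [/cMu //|/andP[aA /asboolP[t [Ets Mta]]]].
  move: aA; rewrite Acu finset.in_setU => /orP[aAc|/cMu //].
  (* [t] and [s] look alike and [t] extends by [a], hence so does [s]. *)
  apply: contrapT => nMsa.
  suff : set0 (rcons t a) by [].
  rewrite -(oM s a Ms aAc nMsa Gsa); split=> //; exists t => //.
  by split=> //; apply: MA; apply: prefix_closure_rcons Mta.
- elim/last_ind: w => [|s a IH] Msa; first exact: closed_loop_nil.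
  have Ms := prefix_closure_rcons Msa.
  apply: closed_loop_rcons; [exact: IH|exact: MG|].
  rewrite /= /enabled finset.in_setU inE.
  have -> : a \in A by apply: (MA _ Msa); rewrite mem_rcons mem_head.
  by apply/orP; right; apply/asboolP; exists s.
Qed.

(** Properness of the plant is what puts the prefix closure of [M], known only
    through the marked language, inside the generated language. *)
Theorem realizationP M : proper_plant G ->
  (exists S : supervisor Au Ao G,
     nonblocking S /\ pmlang (closed_loop S) = M) <->
  [/\ M !=set0, controllable M (plang G) Au, lang_closed M (pmlang G)
    & observable A M (plang G) Ac Ao].
Proof.
move=> [G0 Gm GA]; split=> [[S [nbS SM]]|[M0 cM MN oM]].
- have CM : closed_loop_lang S = prefix_closure M by rewrite -SM nbS.
  split.
  + apply: (prefix_closure_neq0 M).1; rewrite -CM; exact: closed_loop_nil.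
  + exact: closed_loop_controllable CM.
  + by rewrite /lang_closed -CM -SM.
  + exact: closed_loop_observable CM.
- have MG : prefix_closure M `<=` plang G.
    apply: subset_trans Gm; apply: prefix_closure_mono.
    by rewrite MN => w [].
  have CM := realizer_closed_loop M0 MG (subset_trans MG GA) cM oM.
  have SM : pmlang (closed_loop (realizer M)) = M.
    by rewrite /= CM -MN.
  by exists (realizer M); split=> //; rewrite /nonblocking SM /= CM.
Qed.

End Realization.

(** * Coordination control *)

(** A parallel composition projects into each of its components, so [K] being
    the composition of [M1] and [M2] bounds them from below, and [M1], living in
    the coordinated plant, bounds [Mk] from below in turn. *)
Lemma coordinated_mlangE (E : finType) (A1 A2 Ak : {set E})
  {L1 Mk M1 M2 K : set (seq E)} :
  M1 `<=` lang_par A1 L1 Ak Mk ->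
  Mk `<=` proj Ak @` K -> M1 `<=` proj (A1 :|: Ak) @` K ->
  M2 `<=` proj (A2 :|: Ak) @` K ->
  lang_par (A1 :|: Ak) M1 (A2 :|: Ak) M2 = K ->
  [/\ Mk = proj Ak @` K, M1 = proj (A1 :|: Ak) @` K
    & M2 = proj (A2 :|: Ak) @` K].
Proof.
move=> M1k MkK M1K M2K MK.
have KM1 : proj (A1 :|: Ak) @` K `<=` M1.
  by rewrite -MK; apply: proj_lang_par_subl.
have KM2 : proj (A2 :|: Ak) @` K `<=` M2.
  by rewrite -MK; apply: proj_lang_par_subr.
split; apply/seteqP; split=> //.
move=> _ [w Kw <-]; rewrite -(proj_proj _ (finset.subsetUr A1 Ak)).
apply: (@proj_lang_par_subr _ A1 Ak L1); exists (proj (A1 :|: Ak) w) => //.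
by apply: M1k; apply: KM1; exists w.
Qed.

Theorem theorem13 (E : finType) (A1 A2 Ak Sc Su So : {set E})
  (A1_neq0 : A1 != finset.set0) (A2_neq0 : A2 != finset.set0)
  (Ak_neq0 : Ak != finset.set0)
  (subAk : A1 :&: A2 \subset Ak) (Aksub : Ak \subset A1 :|: A2)
  (Scu_cover : Sc :|: Su = A1 :|: A2) (Scu_disj : Sc :&: Su = finset.set0)
  (So_sub : So \subset A1 :|: A2)
  (G1 : generator A1) (G2 : generator A2) (Gk : generator Ak)
  (K : set (seq E)) (K_reg : regular (A1 :|: A2) K)
  (K_sub : K `<=` gen_mlang (gen_par (gen_par G1 G2) Gk))
  (K_dec : cond_decomposable A1 A2 Ak K)
  (Kbar_dec : cond_decomposable A1 A2 Ak (prefix_closure K)) :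
  (exists (Sk : supervisor (Ak :&: Su) (Ak :&: So) Gk)
          (S1 : supervisor ((A1 :|: Ak) :&: Su) ((A1 :|: Ak) :&: So)
                  (plant_par G1 (closed_loop Sk)))
          (S2 : supervisor ((A2 :|: Ak) :&: Su) ((A2 :|: Ak) :&: So)
                  (plant_par G2 (closed_loop Sk))),
     [/\ nonblocking Sk, nonblocking S1 & nonblocking S2] /\
     [/\ pmlang (closed_loop Sk) `<=` proj Ak @` K,
         pmlang (closed_loop S1) `<=` proj (A1 :|: Ak) @` K,
         pmlang (closed_loop S2) `<=` proj (A2 :|: Ak) @` K
       & lang_par (A1 :|: Ak) (pmlang (closed_loop S1))
                  (A2 :|: Ak) (pmlang (closed_loop S2)) = K])
  <->
  [/\ cond_controllable G1 G2 Gk Su K,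
      cond_closed G1 G2 Gk K
    & cond_observable G1 G2 Gk Sc So K].
Proof.
have splitcu (A : {set E}) : A \subset A1 :|: A2 -> A = (A :&: Sc) :|: (A :&: Su).
  by rewrite -finset.setIUr Scu_cover => /finset.setIidPl.
have cuk := splitcu Ak Aksub.
have cu1 : A1 :|: Ak = ((A1 :|: Ak) :&: Sc) :|: ((A1 :|: Ak) :&: Su).
  by apply: splitcu; rewrite finset.subUset finset.subsetUl.
have cu2 : A2 :|: Ak = ((A2 :|: Ak) :&: Sc) :|: ((A2 :|: Ak) :&: Su).
  by apply: splitcu; rewrite finset.subUset finset.subsetUr.
have realk := realizationP (Ak :&: So) cuk (proj Ak @` K) (proper_gen Gk).
(* The loop of a nonblocking coordinator, as a plant in its own right. *)
pose Hk := Plant Ak (prefix_closure (proj Ak @` K)) (proj Ak @` K).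
have real1 := realizationP (G := plant_par G1 Hk)
  ((A1 :|: Ak) :&: So) cu1 (proj (A1 :|: Ak) @` K).
have real2 := realizationP (G := plant_par G2 Hk)
  ((A2 :|: Ak) :&: So) cu2 (proj (A2 :|: Ak) @` K).
have properHk (Sk : supervisor (Ak :&: Su) (Ak :&: So) Gk) :
    nonblocking Sk -> closed_loop Sk = Hk -> proper_plant Hk.
  by move=> nbk <-; apply: proper_closed_loop nbk; apply: proper_gen.
split=> [[Sk [S1 [S2 [[nbk nb1 nb2] [MkK M1K M2K MK]]]]]|].
- have M1k : pmlang (closed_loop S1)
      `<=` lang_par A1 (gen_mlang G1) Ak (pmlang (closed_loop Sk)).
    by move=> w [].
  have [Ek E1 E2] := coordinated_mlangE M1k MkK M1K M2K MK.
  have EHk := nonblocking_closed_loopE nbk Ek.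
  have pHk := properHk Sk nbk EHk.
  have [K0 ck clk ok] := realk.1 (ex_intro _ Sk (conj nbk Ek)).
  rewrite EHk in S1 S2 nb1 nb2 E1 E2 {M1K M2K MK M1k}.
  have [_ c1 cl1 o1] := (real1 (proper_plant_par (proper_gen G1) pHk)).1
    (ex_intro _ S1 (conj nb1 E1)).
  have [_ c2 cl2 o2] := (real2 (proper_plant_par (proper_gen G2) pHk)).1
    (ex_intro _ S2 (conj nb2 E2)).
  split; split=> //.
  by case: K0 => _ [w Kw _]; exists w.
- move=> [[ck c1 c2] [K0 clk cl1 cl2] [ok o1 o2]].
  have PK0 B : (proj B @` K) !=set0.
    by case: K0 => w Kw; exists (proj B w), w.
  have [Sk [nbk Ek]] := realk.2 (And4 (PK0 _) ck clk ok).
  have EHk := nonblocking_closed_loopE nbk Ek.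
  have pHk := properHk Sk nbk EHk.
  exists Sk; rewrite EHk.
  have [S1 [nb1 E1]] := (real1 (proper_plant_par (proper_gen G1) pHk)).2
    (And4 (PK0 _) c1 cl1 o1).
  have [S2 [nb2 E2]] := (real2 (proper_plant_par (proper_gen G2) pHk)).2
    (And4 (PK0 _) c2 cl2 o2).
  by exists S1, S2; rewrite E1 E2 -K_dec; split; split=> //; apply: subset_refl.
Qed.
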